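(* Fix a layer $l\ge2$. If $\phi:\mathbb{R}\to\mathbb{R}$ is Lipschitz on $\mathbb{R}$, then $\mathbf{F}^{(l)}$ and $(\mathbf{F}^{(l)}(n))_{n\ge1}$ belong to $C(\mathbb{R}^I;\mathbb{R}^\infty)$. More precisely, $\mathbf{F}^{(l)}(1),\mathbf{F}^{(l)}(2),\dots$ are $\mathbb{P}$-a.s. Lipschitz on $\mathbb{R}^I$, while the limiting process $\mathbf{F}^{(l)}$ (up to passing to a continuous version) is $\mathbb{P}$-a.s. continuous on $\mathbb{R}^I$ and locally $\gamma$-H\''older continuous for each $0<\gamma<1$.
   Context: Fix $I\in\mathbb{N}$ and $\sigma_\omega^2,\sigma_b^2>0$. On a probability space $(\Omega,\mathcal{H},\mathbb{P})$ let $\omega_{i,j}^{(l)}$ ($i,j,l\ge 1$, with $1\le j\le I$ when $l=1$) be i.i.d. $N(0,\sigma_\omega^2)$ weights and $b_i^{(l)}$ ($i,l\ge1$) i.i.d. $N(0,\sigma_b^2)$ biases, with weights independent of biases. Let $\phi:\mathbb{R}\to\mathbb{R}$ be continuous. Network process: for $x\in\mathbb{R}^I$, $i\ge1$ and $n\ge1$, $$f_i^{(1)}(x,n)=f_i^{(1)}(x)=\sum_{j=1}^I\omega_{i,j}^{(1)}x_j+b_i^{(1)},\qquad f_i^{(l)}(x,n)=\frac1{\sqrt n}\sum_{j=1}^n\omega_{i,j}^{(l)}\,\phi\big(f_j^{(l-1)}(x,n)\big)+b_i^{(l)}\quad(l\ge2).$$ $\mathbf{F}^{(l)}(n)$ is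 the $\mathbb{R}^\infty$-valued process $x\mapsto\mathbf{F}^{(l)}(x,n)=[f_1^{(l)}(x,n),f_2^{(l)}(x,n),\dots]^T$ on $\mathbb{R}^I$. Limiting process: $f_i^{(l)}$ is the centered Gaussian process on $\mathbb{R}^I$ with $(f_i^{(l)}(x^{(1)}),\dots,f_i^{(l)}(x^{(k)}))\sim N_k(\mathbf 0,\Sigma(l))$ for all $x^{(1)},\dots,x^{(k)}\in\mathbb{R}^I$, where $\Sigma(1)_{r,s}=\sigma_b^2+\sigma_\omega^2\langle x^{(r)},x^{(s)}\rangle_{\mathbb{R}^I}$ and, for $l\ge2$, $\Sigma(l)_{r,s}=\sigma_b^2+\sigma_\omega^2\int\phi(u_r)\phi(u_s)\,q^{(l-1)}(\mathrm{d}u)$ with $q^{(l-1)}=N_k(\mathbf 0,\Sigma(l-1))$. The process $\mathbf{F}^{(l)}\stackrel{d}{=}\bigotimes_{i=1}^\infty f_i^{(l)}$ is the $\mathbb{R}^\infty$-valued process whose law is the product of the laws of the $f_i^{(l)}$, $i\ge1$ (independent components). $\mathbb{R}^\infty=\times_{i=1}^\infty\mathbb{R}$ carries the distance $d_\infty(\mathbf a,\mathbf b)=\sum_{i\ge1}2^{-i}\xi(|a_i-b_i|)$, $\xi(t)=t/(1+t)$; continuity, Lipschitz and H\''older properties of $\mathbb{R}^\infty$-valued functions are with respect to $d_\infty$ and the Euclidean norm on $\mathbb{R}^I$. $C(\mathbb{R}^I;\mathbb{R}^\infty)$ is the space of continuous functions $\mathbb{R}^I\to\mathbb{R}^\infty$;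 a process belongs to it if its paths are continuous a.s. (or it has a continuous version). ''$\mathbb{P}$-a.s. Lipschitz'' means that there is a (finite, width-dependent) random variable $H$ such that, $\mathbb{P}$-a.s., $d_\infty(\mathbf{F}^{(l)}(x,n),\mathbf{F}^{(l)}(y,n))\le H\|x-y\|_{\mathbb{R}^I}$ for all $x,y\in\mathbb{R}^I$. A version of a process $Z$ on $\mathbb{R}^I$ is a process $\tilde Z$ with $\mathbb{P}(\tilde Z(x)=Z(x))=1$ for each $x$. Locally $\gamma$-H\''older continuous means $\gamma$-H\''older continuous on every bounded subset of $\mathbb{R}^I$ (with a constant that may depend on the subset and on the path). *)

(* Defs.v *)
(* MathComp / MathComp-Analysis *)
From HB Require Import structures.
From mathcomp Require Import all_boot all_order all_algebra.
From mathcomp Require Import all_classical all_reals all_analysis.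

Set Implicit Arguments.
Unset Strict Implicit.
Unset Printing Implicit Defensive.

Import Order.TTheory GRing.Theory Num.Theory.
Import numFieldNormedType.Exports.

Local Open Scope classical_set_scope.
Local Open Scope ring_scope.

Section Metrics.
Context {R : realType}.

Definition dotp (I : nat) (x y : 'rV[R]_I) : R := \sum_(j < I) x 0 j * y 0 j.

(* The library norm on 'rV[R]_I is the sup norm. *)
Definition enorm (I : nat) (x : 'rV[R]_I) : R := Num.sqrt (dotp x x).

Definition xi (t : R) : R := t / (1 + t).

(* Coordinates of R^oo are indexed from 0, hence the weight 2^-(i+1). *)
Definition dinfty (a b : nat -> R) : R :=
  limn (series (fun i : nat => 2 ^- i.+1 * xi `|a i - b i|)).

Definition dinfty_continuous (I : nat) (g : 'rV[R]_I -> nat -> R) : Prop :=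
  forall (x : 'rV[R]_I) (e : R), 0 < e ->
    exists2 delta : R, 0 < delta &
      forall y, enorm (y - x) < delta -> dinfty (g y) (g x) < e.

Definition lipschitz_with (I : nat) (H : R) (g : 'rV[R]_I -> nat -> R) : Prop :=
  forall x y, dinfty (g x) (g y) <= H * enorm (x - y).

Definition locally_hoelder (I : nat) (gamma : R) (g : 'rV[R]_I -> nat -> R) :
    Prop :=
  forall B : set 'rV[R]_I, (exists M : R, forall x, B x -> enorm x <= M) ->
    exists C : R, forall x y, B x -> B y ->
      dinfty (g x) (g y) <= C * enorm (x - y) `^ gamma.

End Metrics.

Section Independence.
Context {d : measure_display} {T : measurableType d} {R : realType}.
Variable P : probability T R.

Definition mutually_independent (J : Type) (G : J -> set (set T)) : Prop :=
  forall (n : nat) (j : 'I_n -> J) (A : 'I_n -> set T),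
    injective j -> (forall a, G (j a) (A a)) ->
    P (\bigcap_(a in [set: 'I_n]) A a) = (\prod_(a < n) P (A a))%E.

Definition sigma_of_family (S : Type) (X : S -> T -> R) : set (set T) :=
  <<s \bigcup_(s in [set: S]) g_sigma_algebra_preimage (X s) >>.

Definition independent_variables (S : Type) (X : S -> T -> R) : Prop :=
  mutually_independent (fun s => g_sigma_algebra_preimage (X s)).

End Independence.

Section Gaussian.
Context {R : realType}.

(* mu = N(0, v), with N(0, 0) the Dirac mass at 0; normal_prob takes the
   standard deviation and is not degenerate at deviation 0. *)
Definition is_normal0 (v : R) (mu : set R -> \bar R) : Prop :=
  0 <= v /\
  forall A : set R, measurable A ->
    mu A = if v == 0 then \d_(0 : R) A else normal_prob 0 (Num.sqrt v) A.

(* mu = N_k(0, S), S possibly singular: every linear functional t has law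
   N(0, t S t^T) under mu. *)
Definition is_gaussian0 (k : nat) (S : 'M[R]_k)
    (mu : set (k.-tuple R) -> \bar R) : Prop :=
  forall t : 'rV[R]_k,
    is_normal0 ((t *m S *m t^T) 0 0)
      (pushforward mu (fun u : k.-tuple R => \sum_(r < k) t 0 r * tnth u r)).

(* N_k(0, S) itself. For S symmetric positive semidefinite this law exists and
   is unique as a Borel measure; the Dirac mass is only the default value for
   other S. *)
Definition gaussian0 (k : nat) (S : 'M[R]_k) : probability (k.-tuple R) R :=
  xget (\d_([tuple (0 : R) | _ < k]) : probability (k.-tuple R) R)
       [set mu : probability (k.-tuple R) R | is_gaussian0 S mu].

End Gaussian.

(* FirstLayer i j is omega^(1)_(i+1, j+1) and HigherLayer m i j is
   omega^(m+2)_(i+1, j+1). *)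
Inductive weight_index (I : nat) : Type :=
  | FirstLayer (i : nat) (j : 'I_I)
  | HigherLayer (m i j : nat).

Arguments FirstLayer {I} i j.
Arguments HigherLayer {I} m i j.

Section Network.
Context {R : realType} {I : nat}.
Context {d : measure_display} {T : measurableType d} {P : probability T R}.

(* The bias b^(l)_(i+1) of layer l = m+1 is b m i. *)
Definition network_parameters (sw sb : R)
    (w : weight_index I -> {RV P >-> R}) (b : nat -> nat -> {RV P >-> R}) :
    Prop :=
  let b' := fun mi : nat * nat => b mi.1 mi.2 in
  [/\ forall p, is_normal0 (sw ^+ 2) (distribution P (w p)),
      forall mi, is_normal0 (sb ^+ 2) (distribution P (b' mi)),
      independent_variables P w,
      independent_variables P b' &
      mutually_independent P (fun c : bool =>
        if c then sigma_of_family w else sigma_of_family b')].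

(* network l x i is f^(l)_(i+1)(x, n) for l >= 1; the value at l = 0 is
   irrelevant. *)
Fixpoint network (phi : R -> R)
    (w : weight_index I -> T -> R) (b : nat -> nat -> T -> R) (n l : nat)
    (x : 'rV[R]_I) (i : nat) (o : T) {struct l} : R :=
  match l with
  | 0 => 0
  | l'.+1 =>
    match l' with
    | 0 => \sum_(j < I) w (FirstLayer i j) o * x 0 j
    | m.+1 => (Num.sqrt n%:R)^-1 *
        \sum_(j < n) w (HigherLayer m i j) o * phi (network phi w b n l' x j o)
    end + b l' i o
  end.

End Network.

Section Limit.
Context {R : realType} {I : nat}.

(* Sigma(l) at the points x_0, ..., x_(k-1), for l >= 1; the value at l = 0 is
   irrelevant. *)
Fixpoint limit_cov (sw sb : R) (phi : R -> R) (l k : nat)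
    (x : 'I_k -> 'rV[R]_I) {struct l} : 'M[R]_k :=
  match l with
  | 0 => 0
  | l'.+1 =>
    match l' with
    | 0 => \matrix_(r, s) (sb ^+ 2 + sw ^+ 2 * dotp (x r) (x s))
    | _.+1 => \matrix_(r, s) (sb ^+ 2 + sw ^+ 2 *
        \int[gaussian0 (limit_cov sw sb phi l' x)]_u
          (phi (tnth u r) * phi (tnth u s)))
    end
  end.

Context {d : measure_display} {T : measurableType d} {P : probability T R}.

(* The finite-dimensional laws of each component together with the mutual
   independence of the component processes determine the product law. *)
Definition is_limit_process (sw sb : R) (phi : R -> R) (l : nat)
    (F : 'rV[R]_I -> nat -> {RV P >-> R}) : Prop :=
  (forall (i k : nat) (x : 'I_k -> 'rV[R]_I),
     is_gaussian0 (limit_cov sw sb phi l x)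
       (pushforward P (fun o => [tuple F (x r) i o | r < k]))) /\
  mutually_independent P (fun i : nat => sigma_of_family (fun x => F x i)).

Definition is_version (Z' Z : 'rV[R]_I -> nat -> {RV P >-> R}) : Prop :=
  forall x, P [set o | (fun i => Z' x i o) = (fun i => Z x i o)] = 1%E.

End Limit.

(* Main.v *)
(** Width n: the Lipschitz constants of the coordinates are computed layer by
    layer from the weights, and their 2^-i-weighted sum over the coordinates of
    the last layer is finite a.s. because the weights have bounded second
    moments.

    Limit: by induction on the layers the variance of f_i(x) - f_i(y) is at most
    K |x - y|^2, so all even moments give polynomial tails of any order. Chain
    along dyadic points, with a union bound at level m over all pairs of
    neighbouring dyadic points in the box [-2^m, 2^m]^I and over the first m
    coordinates only: the other coordinates contribute at most 2^-m to the
    distance, so no uniformity over infinitely many coordinates is needed, and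
    the growing boxes exhaust the space. *)
Require Import Defs.
From HB Require Import structures.
From mathcomp Require Import all_boot all_order all_algebra.
From mathcomp Require Import all_classical all_reals all_analysis.
From mathcomp Require Import measurable_realfun.
From mathcomp Require Import ring lra zify.

Set Implicit Arguments.
Unset Strict Implicit.
Unset Printing Implicit Defensive.

Import Order.TTheory GRing.Theory Num.Theory.
Import numFieldNormedType.Exports.

Local Open Scope classical_set_scope.
Local Open Scope ring_scope.

(** * Gaussian moments and increments *)

Section NormalMoments.
Import HBNNSimple.

Lemma ge0_integral_density (d : measure_display) (T : measurableType d)
    (R : realType) (mu nu : {measure set T -> \bar R}) (g : T -> R)
    (mg : measurable_fun setT g) (g0 : forall x, 0 <= g x)
    (hnu : forall A, measurable A -> nu A = (\int[mu]_(x in A) (g x)%:E)%E)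
    (f : T -> \bar R) (mf : measurable_fun setT f) (f0 : forall x, (0 <= f x)%E) :
  (\int[nu]_x f x = \int[mu]_x (f x * (g x)%:E))%E.
Proof.
have nnE (h : {nnsfun T >-> R}) :
    (\int[nu]_x (h x)%:E = \int[mu]_x ((h x)%:E * (g x)%:E))%E.
  under [LHS]eq_integral do rewrite fimfunE -fsumEFin//.
  rewrite ge0_integral_fsum//; last 2 first.
  - by move=> r; exact/measurable_EFinP/measurableT_comp.
  - by move=> n x _; rewrite EFinM nnfun_muleindic_ge0.
  under [RHS]eq_integral.
    move=> x xD; rewrite fimfunE -fsumEFin// ge0_mule_fsuml; last first.
      by move=> r; rewrite EFinM nnfun_muleindic_ge0.
    over.
  rewrite ge0_integral_fsum//; last 2 first.
  - move=> r; apply: emeasurable_funM; last exact/measurable_EFinP.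
    by apply/measurable_EFinP; exact: measurableT_comp.
  - move=> n x _; apply: mule_ge0; last by rewrite lee_fin.
    by rewrite EFinM nnfun_muleindic_ge0.
  apply: eq_fsbigr => r _.
  have mA : measurable (h @^-1` [set r]) by exact: measurable_sfunP.
  have [r0|r0] := leP 0 r; last first.
    rewrite preimage_nnfun0//.
    by rewrite !integral0_eq// => x _; rewrite indic0 mulr0// mul0e.
  under eq_integral do rewrite EFinM.
  under [RHS]eq_integral do rewrite EFinM -muleA.
  rewrite !ge0_integralZl//.
  - rewrite integral_indic// setIT hnu// integral_mkcond.
    congr (_ * _)%E; apply: eq_integral => x _.
    rewrite patchE indicE; case: ifPn => _; first by rewrite mul1e.
    by rewrite mul0e.
  - apply: emeasurable_funM; last exact/measurable_EFinP.
    exact/measurable_EFinP/measurable_indic.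
  - by move=> x _; rewrite mule_ge0// lee_fin.
  - exact/measurable_EFinP/measurable_indic.
pose f_ := nnsfun_approx measurableT mf.
transitivity (lim (\int[nu]_x (f_ n x)%:E @[n --> \oo])%E).
  rewrite -monotone_convergence//=.
  - apply: eq_integral => ? /[!inE] xD; apply/esym/cvg_lim => //=.
    exact: cvg_nnsfun_approx.
  - by move=> n; exact/measurable_EFinP/measurable_funTS.
  - by move=> n ? _; rewrite lee_fin.
  - by move=> ? _ ? ? mn; rewrite lee_fin; exact/lefP/nd_nnsfun_approx.
under eq_fun do rewrite nnE.
rewrite -monotone_convergence//=.
- apply: eq_integral => x _; apply/cvg_lim => //=.
  by apply: cvgeZr => //; exact: cvg_nnsfun_approx.
- move=> n; apply: emeasurable_funM; last exact/measurable_EFinP.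
  exact/measurable_EFinP/measurable_funTS.
- by move=> n x _; rewrite mule_ge0 ?lee_fin.
- move=> x _ a b ab; rewrite lee_wpmul2r ?lee_fin//.
  exact/lefP/nd_nnsfun_approx.
Qed.

Lemma expR_mul_exprn_le (R : realType) (u : R) (p : nat) :
  0 <= u -> u ^+ p * expR (- u) <= p`!%:R.
Proof.
move=> u0; rewrite expRN ler_pdivrMr ?expR_gt0//.
case: p => [|p]; first by rewrite expr0 fact0 mul1r -expR0 ler_expR.
have := expR_ge1Dxn p u0.
rewrite -ler_pdivrMl ?ltr0n ?fact_gt0// mulrC.
by move=> h; apply: le_trans h; rewrite lerDr.
Qed.

Definition moment_bound {R : realType} (p : nat) : R :=
  Num.sqrt 2 * 4 ^+ p * p`!%:R.

Lemma moment_bound_gt0 (R : realType) (p : nat) : 0 < moment_bound p :> R.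
Proof. by rewrite !mulr_gt0 ?sqrtr_gt0 ?exprn_gt0// ltr0n fact_gt0. Qed.

(* Half of the Gaussian exponent absorbs the power of x; what remains is the
   density of deviation sqrt 2 * s, of mass one. *)
Lemma normal_moment_le (R : realType) (s : R) (p : nat) : 0 < s ->
  (\int[normal_prob 0 s]_x (x ^+ p.*2)%:E <= (moment_bound p * s ^+ p.*2)%:E)%E.
Proof.
move=> s0; pose s' := Num.sqrt 2 * s.
have s'0 : 0 < s' by rewrite mulr_gt0 ?sqrtr_gt0.
have q2 : Num.sqrt 2 ^+ 2 = 2 :> R by rewrite sqr_sqrtr.
have mX : measurable_fun setT (fun x : R => x ^+ p.*2) by exact: measurable_funX.
have X0 (x : R) : 0 <= x ^+ p.*2 by rewrite exprn_even_ge0 ?odd_double.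
rewrite (@ge0_integral_density _ _ _ lebesgue_measure (normal_prob 0 s)
  (normal_pdf 0 s))//.
- rewrite -[leRHS]mule1 -(integral_normal_pdf 0 s') -ge0_integralZl//=.
  + apply: ge0_le_integral => //=.
    * by move=> x _; rewrite mule_ge0 ?lee_fin// normal_pdf_ge0.
    * apply: emeasurable_funM; first exact/measurable_EFinP.
      by apply/measurable_EFinP; exact: measurable_normal_pdf.
    * apply: emeasurable_funM; first exact: measurable_cst.
      by apply/measurable_EFinP; exact: measurable_normal_pdf.
    * move=> x _; rewrite -!EFinM lee_fin !normal_pdfE ?gt_eqF//.
      have pk : normal_peak s = Num.sqrt 2 * normal_peak s'.
        have s'E : s' ^+ 2 * pi *+ 2 = 2 * (s ^+ 2 * pi *+ 2).
          by rewrite /s' exprMn q2 -mulrA mulrnAr.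
        rewrite /normal_peak s'E sqrtrM// invfM mulrA.
        by rewrite divff ?mul1r// gt_eqF// sqrtr_gt0.
      rewrite pk /normal_fun !subr0; set u := x ^+ 2 / (4 * s ^+ 2).
      have u0 : 0 <= u by rewrite divr_ge0 ?sqr_ge0// mulr_ge0 ?sqr_ge0.
      have -> : - x ^+ 2 / (s ^+ 2 *+ 2) = - u - u.
        by rewrite /u; field; rewrite gt_eqF.
      have -> : - x ^+ 2 / (s' ^+ 2 *+ 2) = - u.
        by rewrite /u /s' exprMn q2; field; rewrite gt_eqF.
      have -> : x ^+ p.*2 = 4 ^+ p * s ^+ p.*2 * u ^+ p.
        rewrite -!mul2n !exprM -!exprMn /u; congr (_ ^+ p).
        by field; rewrite gt_eqF.
      rewrite expRD /moment_bound.
      rewrite [leLHS](_ : _ = (Num.sqrt 2 * 4 ^+ p * s ^+ p.*2 * normal_peak s' *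
        expR (- u)) * (u ^+ p * expR (- u))); last by ring.
      rewrite [leRHS](_ : _ = (Num.sqrt 2 * 4 ^+ p * s ^+ p.*2 * normal_peak s' *
        expR (- u)) * p`!%:R); last by ring.
      apply: ler_wpM2l; last exact: expR_mul_exprn_le.
      by rewrite !mulr_ge0 ?expR_ge0 ?normal_peak_ge0 ?sqrtr_ge0 ?exprn_ge0 ?ltW.
  + by apply/measurable_EFinP; exact: measurable_normal_pdf.
  + by move=> x _; rewrite lee_fin normal_pdf_ge0.
  + by rewrite lee_fin mulr_ge0// ltW// moment_bound_gt0.
- exact: measurable_normal_pdf.
- exact: normal_pdf_ge0.
- exact/measurable_EFinP.
Qed.

End NormalMoments.

Lemma normal0_moment_le (R : realType) (d : measure_display)
    (T : measurableType d) (P : probability T R) (X : T -> R)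
    (mX : measurable_fun setT X) (v : R) (p : nat) :
  is_normal0 v (pushforward P X) -> (0 < p)%N ->
  (\int[P]_o (X o ^+ p.*2)%:E <= (moment_bound p * v ^+ p)%:E)%E.
Proof.
move=> [v0 hv] p0.
have X0 (x : R) : 0 <= x ^+ p.*2 by rewrite exprn_even_ge0 ?odd_double.
pose M : {measure set R -> \bar R} := distribution P (mfun_Sub (mem_set mX)).
have -> : (\int[P]_o (X o ^+ p.*2)%:E = \int[M]_x (x ^+ p.*2)%:E)%E.
  rewrite /M ge0_integral_distribution//.
  by apply/measurable_EFinP; exact: measurable_funX.
have [ve|vn] := eqVneq v 0.
  rewrite (@eq_measure_integral _ _ _ _ (\d_(0:R))); last first.
    by move=> A mA _; have := hv A mA; rewrite ve eqxx.
  rewrite integral_dirac//; last first.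
    by apply/measurable_EFinP; exact: measurable_funX.
  rewrite ve diracT mul1e expr0n double_eq0 gtn_eqF// lee_fin expr0n gtn_eqF//.
  by rewrite mulr0.
have -> : (\int[M]_x (x ^+ p.*2)%:E =
    \int[normal_prob 0 (Num.sqrt v)]_x (x ^+ p.*2)%:E)%E.
  (* normal_prob lives on measurableTypeR R, whose measurable structure is not
     syntactically that of R: transfer it along the identity. *)
  pose idT : measurableTypeR R -> R := idfun.
  have mid : measurable_fun setT idT by exact: (@measurable_id _ _ setT).
  transitivity (\int[pushforward (normal_prob 0 (Num.sqrt v)) idT]_x
      (x ^+ p.*2)%:E)%E.
    apply: eq_measure_integral => A mA _.
    by have := hv A mA; rewrite (negbTE vn).
  rewrite ge0_integral_pushforward//.
    by apply/measurable_EFinP; exact: measurable_funX.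
  by move=> y _; rewrite lee_fin.
have sv : 0 < Num.sqrt v by rewrite sqrtr_gt0 lt_neqAle eq_sym vn.
apply: le_trans (normal_moment_le p sv) _.
by rewrite -mul2n exprM sqr_sqrtr.
Qed.

Lemma lipschitz_bound (R : realType) (phi : R -> R) : lipschitz phi ->
  exists2 L : R, 0 <= L & forall x y, `|phi x - phi y| <= L * `|x - y|.
Proof.
move=> [M [Mreal hM]]; exists (Num.max 0 (M + 1)); first by rewrite le_max lexx.
move=> x y; have M1 : M < Num.max 0 (M + 1) by rewrite lt_max ltrDl ltr01 orbT.
exact: (hM _ M1 (x, y)).
Qed.

Section SquareIntegrable.

Lemma integrable_mul_sq (d : measure_display) (T : measurableType d)
    (R : realType) (P : probability T R) (U V : T -> R)
    (mU : measurable_fun setT U) (mV : measurable_fun setT V) :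
  P.-integrable setT (fun o => (U o ^+ 2)%:E) ->
  P.-integrable setT (fun o => (V o ^+ 2)%:E) ->
  P.-integrable setT (fun o => (U o * V o)%:E).
Proof.
move=> iU iV; have iUV := integrableD measurableT iU iV.
apply: (le_integrable _ _ _ iUV) => //.
  by apply/measurable_EFinP; exact: measurable_funM.
move=> x _ /=; have UV0 : 0 <= U x ^+ 2 + V x ^+ 2 by rewrite addr_ge0// sqr_ge0.
by rewrite lee_fin (ger0_norm UV0) ler_norml; apply/andP; split; nra.
Qed.

Lemma Rintegral_sqrB (d : measure_display) (T : measurableType d)
    (R : realType) (P : probability T R) (U V : T -> R)
    (mU : measurable_fun setT U) (mV : measurable_fun setT V) :
  P.-integrable setT (fun o => (U o ^+ 2)%:E) ->
  P.-integrable setT (fun o => (V o ^+ 2)%:E) ->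
  \int[P]_o (U o * U o) - \int[P]_o (U o * V o) - \int[P]_o (V o * U o) +
    \int[P]_o (V o * V o) = \int[P]_o (U o - V o) ^+ 2.
Proof.
move=> iU iV.
have iUV := integrable_mul_sq mU mV iU iV.
have iVU := integrable_mul_sq mV mU iV iU.
have iUU := integrable_mul_sq mU mU iU iU.
have iVV := integrable_mul_sq mV mV iV iV.
rewrite -RintegralB// -RintegralB//; last exact: (integrableB measurableT iUU iUV).
rewrite -RintegralD//; last first.
  exact: (integrableB measurableT (integrableB measurableT iUU iUV) iVU).
by apply: eq_Rintegral => o _; ring.
Qed.

End SquareIntegrable.

Section GaussianIncrements.
Context {R : realType}.

Definition cov_incr (k : nat) (S : 'M[R]_k) (r s : 'I_k) : R :=
  S r r - S r s - S s r + S s s.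

Lemma gaussian0_coord_normal (k : nat) (S : 'M[R]_k)
    (mu : set (k.-tuple R) -> \bar R) (r : 'I_k) : is_gaussian0 S mu ->
  is_normal0 (S r r) (pushforward mu (fun u : k.-tuple R => tnth u r)).
Proof.
pose t : 'rV[R]_k := delta_mx 0 r; move=> /(_ t).
have -> : (t *m S *m t^T) 0 0 = S r r.
  by rewrite trmx_delta -rowE -colE !mxE.
congr is_normal0; congr pushforward; apply/funext => u.
rewrite (bigD1 r)//= big1 ?addr0 => [|i ir]; rewrite !mxE eqxx/= ?eqxx ?mul1r//.
by rewrite (negbTE ir) mul0r.
Qed.

Lemma gaussian0_incr_normal (k : nat) (S : 'M[R]_k)
    (mu : set (k.-tuple R) -> \bar R) (r s : 'I_k) : is_gaussian0 S mu ->
  is_normal0 (cov_incr S r s)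
    (pushforward mu (fun u : k.-tuple R => tnth u r - tnth u s)).
Proof.
pose t : 'rV[R]_k := delta_mx 0 r - delta_mx 0 s; move=> /(_ t).
have -> : (t *m S *m t^T) 0 0 = cov_incr S r s.
  have -> : t^T = delta_mx r 0 - delta_mx s 0 by rewrite linearB/= !trmx_delta.
  rewrite mulmxBr !mulmxBl -!rowE -!colE !mxE /cov_incr.
  by ring.
congr is_normal0; congr pushforward; apply/funext => u.
have coord (i : 'I_k) :
    \sum_(j < k) (delta_mx 0 i : 'rV[R]_k) 0 j * tnth u j = tnth u i.
  rewrite (bigD1 i)//= big1 ?addr0 => [|j ji]; rewrite !mxE eqxx/= ?eqxx ?mul1r//.
  by rewrite (negbTE ji) mul0r.
rewrite -[tnth u r]coord -[tnth u s]coord -sumrB.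
by apply: eq_bigr => j _; rewrite !mxE mulrBl.
Qed.

Context {phi : R -> R} {L : R} (L0 : 0 <= L).
Hypothesis lipphi : forall x y, `|phi x - phi y| <= L * `|x - y|.
Hypothesis mphi : measurable_fun setT phi.

Let integrable_phi_sq (k : nat) (S : 'M[R]_k)
    (mu : probability (k.-tuple R) R) (r : 'I_k) : is_gaussian0 S mu ->
  mu.-integrable setT (fun u => (phi (tnth u r) ^+ 2)%:E).
Proof.
move=> /(gaussian0_coord_normal r) hr.
have mr : measurable_fun setT (fun u : k.-tuple R => tnth u r).
  exact: measurable_tnth.
have i2 : mu.-integrable setT (fun u : k.-tuple R => (tnth u r ^+ 2)%:E).
  apply/integrableP; split; first by apply/measurable_EFinP; exact: measurable_funX.
  under eq_integral do rewrite gee0_abs ?lee_fin ?sqr_ge0//.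
  exact: le_lt_trans (normal0_moment_le mr hr (isT : 0 < 1)%N) (ltry _).
have ib : mu.-integrable setT (fun u : k.-tuple R =>
    (2 * phi 0 ^+ 2)%:E + (2 * L ^+ 2)%:E * (tnth u r ^+ 2)%:E)%E.
  apply: integrableD => //; last exact: integrableZl.
  exact: finite_measure_integrable_cst.
apply: le_integrable ib => //.
  by apply/measurable_EFinP; apply: measurable_funX; exact: measurableT_comp.
move=> u _ /=; rewrite lee_fin.
have := lipphi (tnth u r) 0; rewrite subr0 => h.
have nn : 0 <= 2 * phi 0 ^+ 2 + 2 * L ^+ 2 * tnth u r ^+ 2.
  by apply: addr_ge0; rewrite mulr_ge0 ?sqr_ge0 ?mulr_ge0 ?sqr_ge0.
rewrite (ger0_norm nn) (ger0_norm (sqr_ge0 _)).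
have h2 : (phi (tnth u r) - phi 0) ^+ 2 <= L ^+ 2 * tnth u r ^+ 2.
  rewrite -[leLHS]real_normK ?num_real// -[X in _ * X]real_normK ?num_real// -exprMn.
  by rewrite ler_sqr ?nnegrE ?mulr_ge0.
by have := sqr_ge0 (phi (tnth u r) - 2 * phi 0); lra.
Qed.

Lemma phi_incr_le (k : nat) (S : 'M[R]_k) (r s : 'I_k) :
  cov_incr (\matrix_(i, j) \int[gaussian0 S]_u (phi (tnth u i) * phi (tnth u j)))
    r s <= L ^+ 2 * moment_bound 1 * Num.max 0 (cov_incr S r s).
Proof.
pose C i j := \int[gaussian0 S]_u (phi (tnth u i) * phi (tnth u j)).
rewrite [leLHS]/cov_incr !mxE -/(C r r) -/(C r s) -/(C s r) -/(C s s).
have mr i : measurable_fun setT (fun u : k.-tuple R => tnth u i).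
  exact: measurable_tnth.
have mpr i : measurable_fun setT (fun u : k.-tuple R => phi (tnth u i)).
  exact: measurableT_comp.
have [[mu hmu]|noG] :=
  pselect (exists mu : probability (k.-tuple R) R, is_gaussian0 S mu).
  have hG : is_gaussian0 S (gaussian0 S).
    suff : [set m : probability (k.-tuple R) R | is_gaussian0 S m] (gaussian0 S) by [].
    by apply: xgetPex; exists mu.
  rewrite /C Rintegral_sqrB//; try exact: integrable_phi_sq hG.
  apply: (@le_trans _ _ (L ^+ 2 * moment_bound 1 * cov_incr S r s)); last first.
    rewrite ler_wpM2l ?le_max ?lexx ?orbT// mulr_ge0 ?sqr_ge0//.
    exact/ltW/moment_bound_gt0.
  rewrite -lee_fin.
  have hd := normal0_moment_le (measurable_funB (mr r) (mr s))
    (gaussian0_incr_normal r s hG) (isT : 0 < 1)%N.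
  have m2 : measurable_fun setT
      (fun u : k.-tuple R => ((tnth u r - tnth u s) ^+ 2)%:E).
    by apply/measurable_EFinP; apply: measurable_funX; exact: measurable_funB.
  have mp2 : measurable_fun setT
      (fun u : k.-tuple R => ((phi (tnth u r) - phi (tnth u s)) ^+ 2)%:E).
    by apply/measurable_EFinP; apply: measurable_funX; exact: measurable_funB.
  have le2 : (\int[gaussian0 S]_u ((phi (tnth u r) - phi (tnth u s)) ^+ 2)%:E <=
      (L ^+ 2 * moment_bound 1 * cov_incr S r s)%:E)%E.
    apply: (@le_trans _ _
        (\int[gaussian0 S]_u ((L ^+ 2)%:E * ((tnth u r - tnth u s) ^+ 2)%:E))%E).
      apply: ge0_le_integral => //.
      - by move=> u _; rewrite lee_fin sqr_ge0.
      - by apply: emeasurable_funM => //; exact: measurable_cst.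
      move=> u _; rewrite -EFinM lee_fin -[leLHS]real_normK ?num_real//.
      rewrite -[X in _ * X]real_normK ?num_real// -exprMn.
      by rewrite ler_sqr ?nnegrE ?mulr_ge0.
    rewrite ge0_integralZl//; last 2 first.
      by move=> u _; rewrite lee_fin sqr_ge0.
      by rewrite lee_fin sqr_ge0.
    rewrite -mulrA [in leRHS]EFinM lee_wpmul2l ?lee_fin ?sqr_ge0//.
  rewrite /Rintegral fineK// ge0_fin_numE; first exact: le_lt_trans le2 (ltry _).
  by apply: integral_ge0 => u _; rewrite lee_fin sqr_ge0.
have CE i j : C i j = phi 0 * phi 0.
  rewrite /C /gaussian0 xgetPN; last by move=> mu hmu; apply: noG; exists mu.
  rewrite /Rintegral integral_dirac//; last first.
    by apply/measurable_EFinP; exact: measurable_funM.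
  by rewrite diracT mul1e /= !tnth_mktuple.
rewrite !CE subrr sub0r addNr.
by rewrite !mulr_ge0 ?sqr_ge0 ?le_max ?lexx// ltW// moment_bound_gt0.
Qed.

End GaussianIncrements.

Lemma dotp_ge0 (R : realType) (I : nat) (x : 'rV[R]_I) : 0 <= dotp x x.
Proof. by apply: sumr_ge0 => i _; rewrite -expr2 sqr_ge0. Qed.

(* The estimate needs no positive semidefiniteness of the lower covariances:
   where gaussian0 takes its default value, a Dirac mass, the increment of the
   next covariance vanishes. *)
Lemma limit_cov_incr_le (R : realType) (I : nat) (sw sb : R) (phi : R -> R)
    (hphi : continuous phi) (hlip : lipschitz phi) (l : nat) :
  exists2 K : R, 0 <= K &
    forall (k : nat) (x : 'I_k -> 'rV[R]_I) (r s : 'I_k),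
    cov_incr (limit_cov sw sb phi l.+1 x) r s <=
      K * dotp (x r - x s) (x r - x s).
Proof.
have [L L0 lipphi] := lipschitz_bound hlip.
have mphi : measurable_fun setT phi by exact: continuous_measurable_fun.
elim: l => [|l [K K0 IH]].
  exists (sw ^+ 2); first exact: sqr_ge0.
  move=> k x r s; rewrite le_eqVlt; apply/orP; left; apply/eqP.
  rewrite /cov_incr /= !mxE.
  have -> : dotp (x r - x s) (x r - x s) =
      dotp (x r) (x r) - dotp (x r) (x s) - dotp (x s) (x r) + dotp (x s) (x s).
    rewrite /dotp -!sumrB -big_split/=; apply: eq_bigr => i _.
    by rewrite !mxE; ring.
  by ring.
exists (sw ^+ 2 * (L ^+ 2 * moment_bound 1 * K)).
  rewrite mulr_ge0 ?sqr_ge0// mulr_ge0// mulr_ge0 ?sqr_ge0//.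
  exact/ltW/moment_bound_gt0.
move=> k x r s.
set S := limit_cov sw sb phi l.+1 x.
have hC := phi_incr_le L0 lipphi mphi S r s.
have -> : cov_incr (limit_cov sw sb phi l.+2 x) r s = sw ^+ 2 * cov_incr
    (\matrix_(i, j) \int[gaussian0 S]_u (phi (tnth u i) * phi (tnth u j))) r s.
  rewrite (_ : limit_cov _ _ _ l.+2 _ = \matrix_(i, j) (sb ^+ 2 + sw ^+ 2 *
    \int[gaussian0 S]_u (phi (tnth u i) * phi (tnth u j))))//.
  by rewrite /cov_incr !mxE; ring.
rewrite -(mulrA (sw ^+ 2)) ler_wpM2l ?sqr_ge0//; apply: le_trans hC _.
rewrite -(mulrA _ K) ler_wpM2l//.
  by rewrite mulr_ge0 ?sqr_ge0//; exact/ltW/moment_bound_gt0.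
by rewrite ge_max mulr_ge0 ?dotp_ge0//= IH.
Qed.

(** * The distance of R^oo and the networks *)

Section Dinfty.
Context {R : realType}.
Implicit Types (a b : nat -> R).

Lemma xi_le_id (t : R) : 0 <= t -> xi t <= t.
Proof. by move=> t0; rewrite /xi ler_pdivrMr ?ltr_pwDl//; nra. Qed.

Lemma xi_le1 (t : R) : 0 <= t -> xi t <= 1.
Proof. by move=> t0; rewrite /xi ler_pdivrMr ?ltr_pwDl//; lra. Qed.

Lemma xi_ge0 (t : R) : 0 <= t -> 0 <= xi t.
Proof. by move=> t0; rewrite /xi divr_ge0// addr_ge0. Qed.

Let u a b (i : nat) : R := 2 ^- i.+1 * xi `|a i - b i|.

Lemma expr2V_gt0 (n : nat) : 0 < 2 ^- n :> R.
Proof. by rewrite invr_gt0 exprn_gt0. Qed.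

Lemma expr2VS (n : nat) : 2 ^- n = 2 ^- n.+1 + 2 ^- n.+1 :> R.
Proof. by rewrite exprS invfM -mulrDl; field; rewrite expf_neq0. Qed.

Let u_ge0 a b i : 0 <= u a b i.
Proof. by rewrite mulr_ge0 ?xi_ge0// ltW// expr2V_gt0. Qed.

Let series_le_head a b (m : nat) (c : R) : 0 <= c ->
  (forall i, (i < m)%N -> `|a i - b i| <= c) ->
  forall n, series (u a b) n <= c + 2 ^- m.
Proof.
move=> c0 hc.
have head n : (n <= m)%N -> series (u a b) n <= c * (1 - 2 ^- n).
  elim: n => [_|n IH nm]; first by rewrite /series/= big_geq// expr0 invr1; lra.
  rewrite /series/= big_nat_recr//=.
  have := IH (ltnW nm); rewrite /series/=.
  have : u a b n <= 2 ^- n.+1 * c.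
    rewrite /u ler_wpM2l ?(ltW (expr2V_gt0 _))//.
    exact: le_trans (xi_le_id _) (hc _ nm).
  by rewrite (expr2VS n); lra.
have tail k : series (u a b) (m + k)%N <= c + (2 ^- m - 2 ^- (m + k)).
  elim: k => [|k]; rewrite ?addn0.
    by have := head m (leqnn m); have := mulr_ge0 c0 (ltW (expr2V_gt0 m)); lra.
  rewrite addnS /series/= big_nat_recr//=.
  have : u a b (m + k)%N <= 2 ^- (m + k).+1.
    by rewrite /u ler_piMr ?(ltW (expr2V_gt0 _))// xi_le1.
  by rewrite (expr2VS (m + k)); lra.
move=> n; have [nm|mn] := leqP n m.
  apply: le_trans (head n nm) _.
  have := mulr_ge0 c0 (ltW (expr2V_gt0 n)); have := expr2V_gt0 m; lra.
by have := tail (n - m)%N; rewrite subnKC ?(ltnW mn)//; have := expr2V_gt0 n; lra.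
Qed.

Lemma dinfty_le a b (M : R) :
  (forall n, \sum_(0 <= i < n) 2 ^- i.+1 * xi `|a i - b i| <= M) ->
  dinfty a b <= M.
Proof.
move=> hM; apply: limr_le; last by apply: nearW => n; exact: hM.
apply: nondecreasing_is_cvgn; last by exists M => _ [n _ <-]; exact: hM.
by apply/nondecreasing_seqP => n; rewrite /series/= big_nat_recr//= lerDl u_ge0.
Qed.

Lemma dinfty_le_head a b (m : nat) (c : R) : 0 <= c ->
  (forall i, (i < m)%N -> `|a i - b i| <= c) -> dinfty a b <= c + 2 ^- m.
Proof. by move=> c0 hc; apply: dinfty_le; exact: series_le_head. Qed.

Lemma dinfty_le1 a b : dinfty a b <= 1.
Proof.
by rewrite -[leRHS]add0r -invr1 -(expr0 2); apply: dinfty_le_head.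
Qed.

End Dinfty.

Section EuclideanNorm.
Context {R : realType} {I : nat}.
Implicit Types x y : 'rV[R]_I.

Lemma enorm_ge0 x : 0 <= enorm x.
Proof. exact: sqrtr_ge0. Qed.

Lemma coord_le_enorm x (j : 'I_I) : `|x 0 j| <= enorm x.
Proof.
rewrite -sqrtr_sqr ler_wsqrtr// /dotp (bigD1 j)//= -expr2 lerDl.
by apply: sumr_ge0 => i _; rewrite -expr2 sqr_ge0.
Qed.

Lemma lipschitz_with_continuous (H : R) (g : 'rV[R]_I -> nat -> R) :
  lipschitz_with H g -> dinfty_continuous g.
Proof.
move=> gH x e e0; have H1 : 0 < `|H| + 1 by rewrite ltr_wpDl.
exists (e / (`|H| + 1)); first by rewrite divr_gt0.
move=> y; rewrite ltr_pdivlMr// => yx; apply: le_lt_trans (gH y x) _.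
apply: le_lt_trans yx; rewrite mulrC ler_wpM2l ?enorm_ge0//.
by have := ler_norm H; lra.
Qed.

End EuclideanNorm.

Section NetworkLipschitz.
Context {R : realType} {I : nat} {d : measure_display} {T : measurableType d}
  {P : probability T R}.
Context (phi : R -> R) (L : R).
Hypothesis L0 : 0 <= L.
Hypothesis lipphi : forall x y, `|phi x - phi y| <= L * `|x - y|.
Context (w : weight_index I -> {RV P >-> R}) (b : nat -> nat -> {RV P >-> R}).

Fixpoint lip_const (n l i : nat) (o : T) {struct l} : R :=
  match l with
  | 0 => 0
  | l'.+1 =>
    match l' with
    | 0 => \sum_(j < I) `|w (FirstLayer i j) o|
    | m.+1 => (Num.sqrt n%:R)^-1 *
        \sum_(j < n) `|w (HigherLayer m i j) o| * (L * lip_const n l' j o)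
    end
  end.

Lemma lip_const_ge0 (n l i : nat) (o : T) : 0 <= lip_const n l i o.
Proof.
elim: l i => [//|[_|l IH]] i; first by rewrite /= sumr_ge0.
apply: mulr_ge0; first by rewrite invr_ge0.
by apply: sumr_ge0 => j _; rewrite mulr_ge0// mulr_ge0//; exact: IH.
Qed.

Lemma network_lipschitz (n l i : nat) (x y : 'rV[R]_I) (o : T) :
  `|network phi w b n l x i o - network phi w b n l y i o| <=
  lip_const n l i o * enorm (x - y).
Proof.
elim: l i => [|[_|m IH]] i; first by rewrite /= subrr normr0 mul0r.
  rewrite /= opprD addrACA subrr addr0 -sumrB mulr_suml (le_trans (ler_norm_sum _ _ _))//.
  apply: ler_sum => j _; rewrite -mulrBr normrM ler_wpM2l//.
  by have := coord_le_enorm (x - y) j; rewrite !mxE.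
rewrite [leLHS](_ : _ = `|(Num.sqrt n%:R)^-1 * \sum_(j < n)
    w (HigherLayer m i j) o * (phi (network phi w b n m.+1 x j o) -
    phi (network phi w b n m.+1 y j o))|); last first.
  rewrite [network _ _ _ _ m.+2 x _ _]/= [network _ _ _ _ m.+2 y _ _]/=.
  rewrite opprD addrACA subrr addr0 -mulrBr -sumrB; congr (`|_ * _|).
  by apply: eq_bigr => j _; rewrite mulrBr.
rewrite normrM ger0_norm ?invr_ge0//.
rewrite [lip_const _ m.+2 _ _]/= -mulrA ler_wpM2l ?invr_ge0//.
rewrite mulr_suml (le_trans (ler_norm_sum _ _ _))//.
apply: ler_sum => j _; rewrite normrM -mulrA ler_wpM2l//.
apply: le_trans (lipphi _ _) _; rewrite -mulrA ler_wpM2l//; exact: IH.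
Qed.

Lemma measurable_lip_const (n l i : nat) : measurable_fun setT (lip_const n l i).
Proof.
elim: l i => [|[_|m IH]] i.
- exact: measurable_cst.
- by apply: measurable_sum => j; exact: measurableT_comp.
- apply: measurable_funM; first exact: measurable_cst.
  apply: measurable_sum => j; apply: measurable_funM.
    exact: measurableT_comp.
  apply: measurable_funM; first exact: measurable_cst.
  exact: IH.
Qed.

Let wsum (m j : nat) (o : T) : \bar R :=
  (\sum_(i <oo) (2 ^- i.+1 * `|w (HigherLayer m i j) o|)%:E)%E.

Let wterm_ge0 (m j i : nat) (o : T) :
  (0 <= (2 ^- i.+1 * `|w (HigherLayer m i j) o|)%:E)%E.
Proof. by rewrite lee_fin mulr_ge0// ltW// expr2V_gt0. Qed.

Let measurable_wterm (m j i : nat) : measurable_fun setT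
  (fun o => (2 ^- i.+1 * `|w (HigherLayer m i j) o|)%:E).
Proof.
apply/measurable_EFinP; apply: measurable_funM; first exact: measurable_cst.
exact: measurableT_comp.
Qed.

Let measurable_wsum (m j : nat) : measurable_fun setT (wsum m j).
Proof.
by apply: ge0_emeasurable_sum => // i o _ _; exact: wterm_ge0.
Qed.

Context {v : R}.
Hypothesis normalw : forall p, is_normal0 v (distribution P (w p)).

Let wsum_finite (m j : nat) : {ae P, forall o, wsum m j o \is a fin_num}.
Proof.
have v0 : 0 <= v by have [] := normalw (HigherLayer 0 0 0).
have iw : P.-integrable setT (wsum m j).
  apply/integrableP; split => //.
  under eq_integral do rewrite gee0_abs ?nneseries_ge0//.
  rewrite integral_nneseries//.
  apply: (@le_lt_trans _ _ (1 + moment_bound 1 * v)%:E); last exact: ltry.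
  apply: lime_le.
    apply: is_cvg_ereal_nneg_natsum_cond => i _ _.
    by apply: integral_ge0 => o _; exact: wterm_ge0.
  apply: nearW => n.
  apply: (@le_trans _ _
      (\sum_(0 <= i < n) (2 ^- i.+1 * (1 + moment_bound 1 * v))%:E)%E).
    apply: lee_sum => i _.
    have m2 : measurable_fun setT (fun o => (w (HigherLayer m i j) o ^+ 2)%:E).
      by apply/measurable_EFinP; apply: measurable_funX.
    apply: (@le_trans _ _ (\int[P]_o
        ((2 ^- i.+1)%:E * (1 + (w (HigherLayer m i j) o ^+ 2)%:E)))%E).
      apply: ge0_le_integral => //.
      - by apply: emeasurable_funM; [exact: measurable_cst|exact: emeasurable_funD].
      - move=> o _; rewrite -EFinD -EFinM lee_fin ler_wpM2l ?(ltW (expr2V_gt0 _))//.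
        rewrite -(real_normK (num_real (w _ o))).
        by have := sqr_ge0 (`|w (HigherLayer m i j) o| - 1); nra.
    rewrite ge0_integralZl//; last 2 first.
    - exact: emeasurable_funD.
    - by move=> o _; rewrite -EFinD lee_fin addr_ge0 ?sqr_ge0.
    rewrite EFinM lee_wpmul2l ?lee_fin ?(ltW (expr2V_gt0 _))//.
    rewrite ge0_integralD//; last by move=> o _; rewrite lee_fin sqr_ge0.
    rewrite integral_cst// mul1e EFinD leeD//; first exact: probability_le1.
    have mw : measurable_fun setT (w (HigherLayer m i j)) by [].
    have := normal0_moment_le mw (normalw _) (isT : (0 < 1)%N).
    by rewrite expr1.
  rewrite sumEFin lee_fin -mulr_suml ler_piMl//.
    by rewrite addr_ge0// mulr_ge0// ltW// moment_bound_gt0.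
  suff -> : \sum_(0 <= i < n) 2 ^- i.+1 = 1 - 2 ^- n :> R.
    by rewrite gerBl ltW// expr2V_gt0.
  elim: n => [|n IH]; first by rewrite big_geq// expr0 invr1 subrr.
  by rewrite big_nat_recr//= IH (expr2VS n); ring.
by have := integrable_ae measurableT iw; apply: filterS => o; exact.
Qed.

Lemma network_ae_lipschitz (n m : nat) : exists H : {RV P >-> R},
  {ae P, forall o,
    lipschitz_with (H o) (fun x i => network phi w b n m.+2 x i o)}.
Proof.
pose H o := (Num.sqrt n%:R)^-1 *
  \sum_(j < n) (L * lip_const n m.+1 j o) * fine (wsum m j o).
have mH : measurable_fun setT H.
  apply: measurable_funM; first exact: measurable_cst.
  apply: measurable_sum => j; apply: measurable_funM.
    apply: measurable_funM; first exact: measurable_cst.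
    exact: measurable_lip_const.
  exact: measurableT_comp (measurable_wsum m j).
exists (mfun_Sub (mem_set mH)).
have : {ae P, forall o, forall j, wsum m j o \is a fin_num}.
  by apply: ae_foralln => j; exact: wsum_finite.
apply: filterS => o fin x y; apply: dinfty_le => N.
apply: (@le_trans _ _ (\sum_(0 <= i < N)
    2 ^- i.+1 * (lip_const n m.+2 i o * enorm (x - y)))).
  apply: ler_sum => i _; rewrite ler_wpM2l ?(ltW (expr2V_gt0 _))//.
  apply: le_trans (xi_le_id (normr_ge0 _)) _; exact: network_lipschitz.
under eq_bigr do rewrite mulrA.
rewrite -mulr_suml ler_wpM2r ?enorm_ge0// /H.
under eq_bigr do rewrite [lip_const _ m.+2 _ _]/= mulrCA mulr_sumr.
rewrite -mulr_sumr ler_wpM2l ?invr_ge0// exchange_big/=.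
apply: ler_sum => j _.
under eq_bigr do rewrite mulrA mulrC.
rewrite -mulr_sumr ler_wpM2l//.
  by rewrite mulr_ge0//; exact: (lip_const_ge0 n m.+1).
rewrite -lee_fin fineK// -sumEFin; apply: nneseries_lim_ge => i _ _.
exact: wterm_ge0.
Qed.

End NetworkLipschitz.

Lemma normal0_tail_le (R : realType) (d : measure_display)
    (T : measurableType d) (P : probability T R) (X : T -> R)
    (mX : measurable_fun setT X) (v t : R) (p : nat) :
  is_normal0 v (pushforward P X) -> (0 < p)%N -> 0 < t ->
  (P [set o | t <= `|X o|]%R <= (moment_bound p * v ^+ p / t ^+ p.*2)%:E)%E.
Proof.
move=> hX p0 t0; have tp : 0 < t ^+ p.*2 by rewrite exprn_gt0.
have := @markov _ _ _ P (mfun_Sub (mem_set mX)) (fun x => x ^+ p.*2) t t0.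
rewrite unlock /= => /(_ (measurable_funX _ _)) h.
have {h} : ((t ^+ p.*2)%:E * P [set o | t <= `|X o|]%R <=
    \int[P]_o (X o ^+ p.*2)%:E)%E.
  apply: le_trans (h _ _ _) _ => //.
  - by move=> r r0; rewrite exprn_ge0.
  - by move=> x y x0 y0 xy; rewrite lerXn2r.
  - rewrite le_eqVlt; apply/orP; left; apply/eqP; apply: eq_integral => o _.
    by rewrite -mul2n !exprM real_normK ?num_real.
move/le_trans => /(_ _ (normal0_moment_le mX hX p0)) h.
by rewrite mulrC EFinM lee_pdivlMl.
Qed.

Section BorelCantelli.
Context {R : realType} {d : measure_display} {T : measurableType d}
  {P : probability T R}.

Lemma borel_cantelli_geometric (A : nat -> set T) (C q : R) :
  0 <= C -> 0 <= q < 1 -> (forall n, measurable (A n)) ->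
  (forall n, (P (A n) <= (C * q ^+ n)%:E)%E) ->
  {ae P, forall o, exists N, forall n, (N <= n)%N -> ~ A n o}.
Proof.
move=> C0 /andP[q0 q1] mA hA.
have q1' : 0 < 1 - q by rewrite subr_gt0.
have A0 : P (lim_sup_set A) = 0%E.
  apply: lim_sup_set_cvg0 => //.
  apply: (@le_lt_trans _ _ (C / (1 - q))%:E); last exact: ltry.
  apply: lime_le; first exact: is_cvg_ereal_nneg_natsum_cond.
  apply: nearW => n.
  apply: (@le_trans _ _ (\sum_(0 <= i < n) (C * q ^+ i)%:E)%E).
    by apply: lee_sum => i _; exact: hA.
  rewrite sumEFin lee_fin -mulr_sumr ler_wpM2l//.
  rewrite -[leRHS]mul1r ler_pdivlMr// mulrC.
  suff -> : (1 - q) * \sum_(0 <= i < n) q ^+ i = 1 - q ^+ n.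
    by rewrite gerBl exprn_ge0.
  by rewrite big_mkord -opprB mulNr -subrX1 opprB.
exists (lim_sup_set A); split => //.
  apply: bigcap_measurable => // k _; exact: bigcup_measurable.
move=> o /= ho n _; apply: contrapT => hn; apply: ho; exists n => m nm Amo.
by apply: hn; exists m.
Qed.

End BorelCantelli.

Lemma bigsetU_measure_le (R : realType) (d : measure_display)
    (T : measurableType d) (P : probability T R) (J : finType) (Q : pred J)
    (A : J -> set T) (e : R) : 0 <= e ->
  (forall z, Q z -> measurable (A z) /\ (P (A z) <= e%:E)%E) ->
  measurable (\big[setU/set0]_(z | Q z) A z) /\
  (P (\big[setU/set0]_(z | Q z) A z) <= (#|J|%:R * e)%:E)%E.
Proof.
move=> e0 hA.
have [mU hU] : measurable (\big[setU/set0]_(z | Q z) A z) /\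
    (P (\big[setU/set0]_(z | Q z) A z) <= (\sum_(z | Q z) e)%:E)%E.
  apply: (big_rec2 (fun (U : set T) (s : R) => measurable U /\ (P U <= s%:E)%E)).
    by rewrite measure0.
  move=> z U s Qz [mU hU]; have [mz hz] := hA z Qz.
  split; first exact: measurableU.
  by apply: le_trans (measureU2 _ _ _) _ => //; rewrite EFinD leeD.
split => //; apply: le_trans hU _; rewrite lee_fin.
apply: (@le_trans _ _ (\sum_(z : J) e)).
  by rewrite [leRHS](bigID Q)/= lerDl sumr_ge0.
by rewrite sumr_const mulr_natl.
Qed.

(** * Dyadic chaining *)

Section Dyadic.
Context {R : realType} {I : nat}.
Implicit Types x y : 'rV[R]_I.

(* k j <= 2 * 4^m, so these are the multiples of 2^-m in the box [-2^m, 2^m]^I. *)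
Definition grid_pt (m : nat) (k : {ffun 'I_I -> 'I_(2 * 4 ^ m).+1}) : 'rV[R]_I :=
  \row_j ((k j)%:R / 2 ^+ m - 2 ^+ m).

Arguments grid_pt : clear implicits.

Definition grid_near (m : nat) x y : bool :=
  [forall j, `|x 0 j - y 0 j| <= 2 / 2 ^+ m].

Definition dyadic (m : nat) x : 'rV[R]_I :=
  \row_j ((Num.floor (2 ^+ m * x 0 j))%:~R / 2 ^+ m).

Definition in_box (m : nat) x : Prop := forall j, `|x 0 j| <= 2 ^+ m.

Lemma grid_ptP (m : nat) x :
  (forall j, exists2 z : int, x 0 j = z%:~R / 2 ^+ m & `|z%:~R| <= 4 ^+ m :> R) ->
  exists k, x = grid_pt m k.
Proof.
move=> hx.
have hk j : exists n : 'I_(2 * 4 ^ m).+1, x 0 j = n%:R / 2 ^+ m - 2 ^+ m.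
  have [z zE] := hx j; rewrite ler_norml => /andP[z1 z2].
  have e4 : (4 ^ m)%:Z%:~R = 4 ^+ m :> R by rewrite -pmulrn natrX.
  have z0 : 0 <= z + (4 ^ m)%:Z.
    by rewrite -(ler_int R) rmorphD/= e4; lra.
  have zM : (absz (z + (4 ^ m)%:Z)%R < (2 * 4 ^ m).+1)%N.
    rewrite ltnS -lez_nat gez0_abs// -(ler_int R) rmorphD/= e4.
    by rewrite -pmulrn natrM natrX; lra.
  exists (Ordinal zM); rewrite zE /= natr_absz ger0_norm// rmorphD/= e4 mulrDl.
  have -> : 4 ^+ m = 2 ^+ m * 2 ^+ m :> R by rewrite -exprMn; congr (_ ^+ m); ring.
  by rewrite mulfK ?gt_eqF// addrK.
have [k kE] := choice hk.
by exists [ffun j => k j]; apply/rowP => j; rewrite !mxE ffunE kE.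
Qed.

Lemma dyadic_itv (m : nat) x j :
  dyadic m x 0 j <= x 0 j < dyadic m x 0 j + 2 ^- m.
Proof.
rewrite mxE; have /andP[h1 h2] := floor_itv (2 ^+ m * x 0 j).
rewrite ler_pdivrMr// [x 0 j * _]mulrC h1/=.
have -> (z : R) : z / 2 ^+ m + 2 ^- m = (z + 1) / 2 ^+ m by rewrite mulrDl mul1r.
by rewrite ltr_pdivlMr// [x 0 j * _]mulrC; rewrite rmorphD in h2.
Qed.

Lemma floor_scaled_le (m : nat) x j : in_box m x ->
  `|(Num.floor (2 ^+ m * x 0 j))%:~R| <= 4 ^+ m :> R.
Proof.
move=> /(_ j); rewrite !ler_norml => /andP[x1 x2].
have E : 4 ^+ m = 2 ^+ m * 2 ^+ m :> R by rewrite -exprMn; congr (_ ^+ m); ring.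
have b1 : - 4 ^+ m <= 2 ^+ m * x 0 j by rewrite E -mulrN ler_pM2l.
have b2 : 2 ^+ m * x 0 j <= 4 ^+ m by rewrite E ler_pM2l.
rewrite (le_trans (floor_le _) b2) andbT.
have -> : - 4 ^+ m = (- (4 ^ m)%:Z)%:~R :> R by rewrite rmorphN/= -pmulrn natrX.
by rewrite ler_int floor_ge_int rmorphN/= -pmulrn natrX.
Qed.

Lemma dyadic_grid (m : nat) x : in_box m x -> exists k, dyadic m x = grid_pt m k.
Proof.
move=> hx; apply: grid_ptP => j; rewrite mxE.
by exists (Num.floor (2 ^+ m * x 0 j)) => //; exact: floor_scaled_le.
Qed.

Lemma dyadic_gridS (m : nat) x :
  in_box m x -> exists k, dyadic m x = grid_pt m.+1 k.
Proof.
move=> hx; apply: grid_ptP => j; rewrite mxE.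
exists (2 * Num.floor (2 ^+ m * x 0 j)).
  by rewrite rmorphM/= exprS invfM mulrACA divff ?mul1r.
rewrite rmorphM/= normrM ger0_norm// exprS.
have := floor_scaled_le j hx; have := normr_ge0 ((Num.floor (2 ^+ m * x 0 j))%:~R : R).
by lra.
Qed.

Lemma in_boxW (m n : nat) x : (m <= n)%N -> in_box m x -> in_box n x.
Proof.
by move=> mn hx j; apply: le_trans (hx j) _; rewrite ler_weXn2l// ler1n.
Qed.

Lemma dyadic_nearS (m : nat) x : grid_near m.+1 (dyadic m x) (dyadic m.+1 x).
Proof.
apply/forallP => j.
have /andP[a1 a2] := dyadic_itv m x j; have /andP[b1 b2] := dyadic_itv m.+1 x j.
have := expr2V_gt0 (R := R) m.+1; have E := expr2VS (R := R) m => h.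
rewrite ler_norml (_ : 2 / 2 ^+ m.+1 = 2 ^- m); last first.
  by rewrite exprS invfM mulrA divff ?mul1r.
by apply/andP; split; lra.
Qed.

Lemma dyadic_near (m : nat) x y : (forall j, `|x 0 j - y 0 j| <= 2 ^- m) ->
  grid_near m (dyadic m x) (dyadic m y).
Proof.
move=> hxy; apply/forallP => j.
have /andP[a1 a2] := dyadic_itv m x j; have /andP[b1 b2] := dyadic_itv m y j.
have := hxy j; rewrite !ler_norml => /andP[c1 c2].
by apply/andP; split; lra.
Qed.

Lemma grid_near_dotp (m : nat) x y : grid_near m x y ->
  dotp (x - y) (x - y) <= I%:R * 4 * 4 ^- m.
Proof.
move=> /forallP hxy.
have -> : I%:R * 4 * 4 ^- m = \sum_(j < I) 4 * 4 ^- m :> R.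
  by rewrite sumr_const card_ord -mulrA mulr_natl.
apply: ler_sum => j _; rewrite !mxE -expr2 -real_normK ?num_real//.
have -> : 4 * 4 ^- m = (2 / 2 ^+ m) ^+ 2 :> R.
  rewrite exprMn exprVn -exprM mulnC exprM; congr (_ * (_ ^+ m)^-1); ring.
by rewrite ler_sqr ?nnegrE ?divr_ge0 ?exprn_ge0.
Qed.

Definition dyadic_modulus (theta : R) (N : nat) (f : 'rV[R]_I -> nat -> R) : Prop :=
  forall (m i : nat) k k', (N <= m)%N -> (i < m)%N ->
    grid_near m (grid_pt m k) (grid_pt m k') ->
    `|f (grid_pt m k) i - f (grid_pt m k') i| <= theta ^+ m.

Lemma dyadic_modulusW (theta theta' : R) (N : nat) (f : 'rV[R]_I -> nat -> R) :
  0 <= theta <= theta' -> dyadic_modulus theta N f -> dyadic_modulus theta' N f.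
Proof.
move=> /andP[t0 tt] hf m i k k' Nm im kk; apply: le_trans (hf _ _ _ _ Nm im kk) _.
by rewrite lerXn2r ?nnegrE// (le_trans t0).
Qed.

Section Chaining.
Context (theta : R) (N : nat) (f : 'rV[R]_I -> nat -> R).
Hypothesis theta01 : 0 < theta < 1.
Hypothesis hf : dyadic_modulus theta N f.

Let c := (1 - theta)^-1.

Let t0 : 0 < theta. Proof. by case/andP: theta01. Qed.
Let t1 : 0 < 1 - theta. Proof. by rewrite subr_gt0; case/andP: theta01. Qed.
Let c0 : 0 < c. Proof. by rewrite invr_gt0. Qed.

Lemma dyadic_chain (m i k : nat) x : (N <= m)%N -> (i < m)%N -> in_box m x ->
  `|f (dyadic (m + k) x) i - f (dyadic m x) i| <= c * theta ^+ m.
Proof.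
move=> Nm im hx.
suff : `|f (dyadic (m + k) x) i - f (dyadic m x) i| <=
    c * (theta ^+ m - theta ^+ (m + k)).
  move/le_trans; apply; rewrite ler_pM2l// gerBl exprn_ge0// ltW//.
elim: k => [|k IH]; first by rewrite addn0 !subrr normr0 mulr0.
have bx : in_box (m + k)%N x by apply: in_boxW hx; rewrite leq_addr.
have [p pE] := dyadic_gridS bx.
have [q qE] := dyadic_grid (in_boxW (leqnSn _) bx).
have step : `|f (dyadic (m + k).+1 x) i - f (dyadic (m + k) x) i| <=
    theta ^+ (m + k).+1.
  rewrite distrC; have := dyadic_nearS (m + k) x; rewrite pE qE => near_pq.
  by apply: hf => //; lia.
rewrite addnS -[X in `|X|](subrKA (f (dyadic (m + k) x) i)).
apply: le_trans (ler_normD _ _) _; apply: le_trans (lerD step IH) _.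
have stepE : theta ^+ (m + k) = c * (theta ^+ (m + k) - theta ^+ (m + k).+1).
  by rewrite exprS -{2}[theta ^+ (m + k)]mul1r -mulrBl mulrA mulVf ?mul1r// gt_eqF.
apply: (@le_trans _ _ (theta ^+ (m + k) + c * (theta ^+ m - theta ^+ (m + k)))).
  by rewrite lerD2r exprS ler_piMl ?exprn_ge0 ?(ltW t0)//; move: t1; lra.
by rewrite [X in X + _ <= _]stepE -mulrDr ler_pM2l//; lra.
Qed.

Lemma dyadic_cvg (i : nat) x : cvgn (fun m => f (dyadic m x) i).
Proof.
have [m0 [Nm0 im0 hx]] : exists m, [/\ (N <= m)%N, (i < m)%N & in_box m x].
  pose M := \sum_(j < I) `|x 0 j|.
  pose n := maxn (maxn N i.+1) (Num.truncn M).+1.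
  exists n; split; [by rewrite /n; lia|by rewrite /n; lia|move=> j].
  apply: (@le_trans _ _ M).
    by rewrite /M (bigD1 j)//= lerDl sumr_ge0.
  apply: le_trans (ltW (truncnS_gt M)) _.
  apply: (@le_trans _ _ n%:R).
    by rewrite ler_nat /n leq_maxr.
  by rewrite -natrX ler_nat ltnW// ltn_expl.
apply: cauchy_cvg; apply: cauchy_exP => e e0.
have : \forall m \near \oo, `|c * theta ^+ m| < e.
  apply: cvgr0_norm_lt => //; rewrite -[X in _ --> X](mulr0 c).
  apply: cvgM; first exact: cvg_cst.
  by apply: cvg_expr; rewrite (ger0_norm (ltW t0)); move: t1; lra.
move=> [m1 _ hm1]; pose m := maxn m0 m1.
exists (f (dyadic m x) i); exists m => //= n mn.
rewrite /ball/= distrC; apply: le_lt_trans (hm1 m _); last by rewrite /= /m; lia.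
have cm0 : 0 <= c * theta ^+ m by rewrite mulr_ge0 ?exprn_ge0 ?ltW.
rewrite (ger0_norm cm0) -(subnKC mn).
apply: dyadic_chain; [by rewrite /m; lia|by rewrite /m; lia|].
by apply: in_boxW hx; rewrite /m; lia.
Qed.

Definition dyadic_lim x (i : nat) : R := limn (fun m => f (dyadic m x) i).

Lemma dyadic_lim_near (m i : nat) x : (N <= m)%N -> (i < m)%N -> in_box m x ->
  `|dyadic_lim x i - f (dyadic m x) i| <= c * theta ^+ m.
Proof.
move=> Nm im hx.
have h : (fun k => f (dyadic (m + k) x) i) @ \oo --> dyadic_lim x i.
  have : (fun k => f (dyadic k x) i) @ \oo --> dyadic_lim x i by exact: dyadic_cvg.
  by rewrite -(cvg_shiftn m); under eq_fun do rewrite addnC.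
have {}h : (fun k => `|f (dyadic (m + k) x) i - f (dyadic m x) i|) @ \oo -->
    `|dyadic_lim x i - f (dyadic m x) i|.
  by apply: cvg_norm; apply: cvgB h _; exact: cvg_cst.
rewrite -(cvg_lim _ h)//; apply: limr_le; first by apply/cvg_ex; eexists; exact: h.
by apply: nearW => k; exact: dyadic_chain.
Qed.

Lemma dinfty_dyadic_lim_le (m : nat) x y : 1 / 2 <= theta ->
  (N <= m)%N -> in_box m x -> in_box m y ->
  (forall j, `|x 0 j - y 0 j| <= 2 ^- m) ->
  dinfty (dyadic_lim x) (dyadic_lim y) <= (2 * c + 2) * theta ^+ m.
Proof.
move=> th2 Nm hx hy hxy; have tm0 : 0 <= theta ^+ m by rewrite exprn_ge0 ?ltW.
apply: (@le_trans _ _ ((2 * c + 1) * theta ^+ m + 2 ^- m)); last first.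
  have : 2 ^- m <= theta ^+ m :> R.
    by rewrite -exprVn lerXn2r ?nnegrE ?invr_ge0 ?(ltW t0)//; lra.
  by lra.
apply: dinfty_le_head => [|i im].
  by rewrite mulr_ge0// addr_ge0// mulr_ge0// ltW.
have hgx := dyadic_lim_near Nm im hx; have hgy := dyadic_lim_near Nm im hy.
have := dyadic_near hxy; have [p pE] := dyadic_grid hx.
have [q qE] := dyadic_grid hy; rewrite pE qE => near_pq.
have := hf Nm im near_pq; rewrite -pE -qE.
move: hgx hgy; rewrite !ler_norml => /andP[? ?] /andP[? ?] /andP[? ?].
by apply/andP; split; lra.
Qed.

End Chaining.

Lemma powR_dyadic (gamma : R) (m : nat) :
  (2 `^ (- gamma)) ^+ m = (2 ^- m) `^ gamma.
Proof.
rewrite -powR_mulrn ?powR_ge0// -powRrM.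
have -> : 2 ^- m = 2 `^ (- m%:R) :> R by rewrite powRN powR_mulrn.
by rewrite -powRrM; congr (_ `^ _); ring.
Qed.

Lemma powR2N_itv (gamma : R) : 0 < gamma < 1 -> 1 / 2 < 2 `^ (- gamma) < 1.
Proof.
move=> /andP[g0 g1]; have l2 : 0 < ln 2 :> R by rewrite ln_gt0// ltr1n.
rewrite mul1r -powR_inv1// /powR gt_eqF// ltr_expR ltr_pM2r// ltrN2 g1/=.
by rewrite -[ltRHS]expR0 ltr_expR mulNr oppr_lt0 mulr_gt0.
Qed.

Lemma enorm_eq0 x : enorm x = 0 -> x = 0.
Proof.
move=> x0; apply/rowP => j; rewrite mxE; apply/eqP; rewrite -normr_eq0.
by rewrite eq_le normr_ge0 andbT -x0 coord_le_enorm.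
Qed.

Lemma dyadic_scaleP (e : R) (m0 : nat) : 0 < e <= 2 ^- m0 ->
  exists m, (m0 <= m)%N /\ 2 ^- m.+1 <= e <= 2 ^- m.
Proof.
move=> /andP[e0 em0].
have [n] : exists n, 2 ^- n.+1 <= e.
  exists (Num.truncn e^-1); rewrite -[leRHS]invrK lef_pV2 ?posrE ?invr_gt0//.
  apply: le_trans (ltW (truncnS_gt _)) _.
  by rewrite -natrX ler_nat ltnW// ltn_expl.
elim: n => [|n IH] he.
  exists m0; split => //; rewrite em0 andbT; apply: le_trans he.
  by rewrite lef_pV2 ?posrE ?exprn_gt0// ler_weXn2l ?ler1n.
have [/IH//|/ltW en] := leP (2 ^- n.+1) e.
have [m0n|nm0] := leqP m0 n.+1; first by exists n.+1; rewrite he en.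
exists m0; split => //; rewrite em0 andbT; apply: le_trans he.
by rewrite lef_pV2 ?posrE ?exprn_gt0// ler_weXn2l ?ler1n ?(leqW nm0).
Qed.

Lemma dyadic_lim_locally_hoelder (gamma : R) (N : nat)
    (f : 'rV[R]_I -> nat -> R) : 0 < gamma < 1 ->
  dyadic_modulus (2 `^ (- gamma)) N f -> locally_hoelder gamma (dyadic_lim f).
Proof.
move=> /andP[g0 g1] hf B [M hM]; set theta := 2 `^ (- gamma) in hf.
have th0 : 0 < theta by rewrite powR_gt0.
have /andP[/ltW th2 th1] : 1 / 2 < theta < 1 by apply: powR2N_itv; rewrite g0.
have th01 : 0 < theta < 1 by rewrite th0.
pose m0 := maxn N (Num.truncn M).+1.
have boxB m x : (m0 <= m)%N -> B x -> in_box m x.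
  move=> mm Bx j; apply: le_trans (coord_le_enorm x j) _.
  apply: le_trans (hM x Bx) _; apply: le_trans (ltW (truncnS_gt M)) _.
  rewrite -natrX ler_nat; apply: (@leq_trans m); last by rewrite ltnW// ltn_expl.
  by apply: leq_trans mm; rewrite leq_maxr.
pose C := (2 * (1 - theta)^-1 + 2) / theta.
have C0 : 0 <= C.
  by rewrite divr_ge0 ?(ltW th0)// addr_ge0// mulr_ge0// invr_ge0; lra.
have D0 : 0 <= theta ^- m0 by rewrite invr_ge0 exprn_ge0 ?ltW.
exists (C + theta ^- m0) => x y Bx By.
have [e0|en] := eqVneq (enorm (x - y)) 0.
  rewrite e0 powR0 ?gt_eqF// mulr0.
  have -> : x = y by apply/eqP; rewrite -subr_eq0; apply/eqP; exact: enorm_eq0.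
  apply: dinfty_le => n; rewrite big1// => i _.
  by rewrite subrr normr0 /xi mul0r mulr0.
have e0 : 0 < enorm (x - y) by rewrite lt_neqAle eq_sym en enorm_ge0.
rewrite mulrDl; have [em|/ltW em] := leP (enorm (x - y)) (2 ^- m0); last first.
  apply: le_trans (dinfty_le1 _ _) _.
  have : 1 <= theta ^- m0 * enorm (x - y) `^ gamma.
    rewrite mulrC ler_pdivlMr ?exprn_gt0// mul1r powR_dyadic.
    by rewrite ge0_ler_powR ?nnegrE ?(ltW g0) ?(ltW e0) ?(ltW (expr2V_gt0 _)).
  by move/le_trans; apply; rewrite lerDr mulr_ge0 ?powR_ge0.
have [|m [m0m /andP[em1 em2]]] := @dyadic_scaleP (enorm (x - y)) m0.
  by rewrite e0.
apply: (@le_trans _ _ (C * enorm (x - y) `^ gamma)); last first.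
  by rewrite lerDl mulr_ge0 ?powR_ge0.
have Nm : (N <= m)%N by apply: leq_trans m0m; rewrite leq_maxl.
have xy j : `|x 0 j - y 0 j| <= 2 ^- m.
  by have := coord_le_enorm (x - y) j; rewrite !mxE => /le_trans; apply.
apply: le_trans (dinfty_dyadic_lim_le th01 hf th2 Nm (boxB m x m0m Bx)
  (boxB m y m0m By) xy) _.
rewrite /C -mulrA ler_wpM2l//.
  by rewrite addr_ge0// mulr_ge0// invr_ge0; lra.
rewrite mulrC ler_pdivlMr// -exprSr powR_dyadic.
by rewrite ge0_ler_powR ?nnegrE ?(ltW g0) ?(ltW e0) ?(ltW (expr2V_gt0 _)).
Qed.

Lemma locally_hoelder_continuous (gamma : R) (g : 'rV[R]_I -> nat -> R) :
  0 < gamma -> locally_hoelder gamma g -> dinfty_continuous g.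
Proof.
move=> g0 hg x e e0.
have [|C hC] := hg [set y | enorm (y - x) <= 1].
  exists (Num.sqrt (\sum_(j < I) (`|x 0 j| + 1) ^+ 2)) => y /= yx.
  rewrite ler_wsqrtr//; apply: ler_sum => j _.
  rewrite -expr2 -real_normK ?num_real// lerXn2r ?nnegrE ?addr_ge0//.
  have := le_trans (coord_le_enorm (y - x) j) yx; rewrite !mxE => h.
  by rewrite -[y 0 j](subrK (x 0 j)) addrC (le_trans (ler_normD _ _))// lerD2l.
have C0 : 0 < `|C| + 1 by rewrite ltr_wpDl.
exists (Num.min 1 ((e / (`|C| + 1)) `^ gamma^-1)).
  by rewrite lt_min ltr01 powR_gt0// divr_gt0.
move=> y; rewrite lt_min => /andP[y1 y2].
apply: le_lt_trans (hC y x (ltW y1) _) _.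
  by rewrite /= subrr /enorm /dotp big1 ?sqrtr0// => j _; rewrite mxE mul0r.
apply: (@le_lt_trans _ _ ((`|C| + 1) * enorm (y - x) `^ gamma)).
  by rewrite ler_wpM2r ?powR_ge0//; have := ler_norm C; lra.
rewrite mulrC -ltr_pdivlMr//.
have -> : e / (`|C| + 1) = ((e / (`|C| + 1)) `^ gamma^-1) `^ gamma.
  by rewrite -powRrM mulVf ?gt_eqF// powRr1// divr_ge0 ?ltW.
by rewrite gt0_ltr_powR ?nnegrE ?enorm_ge0 ?powR_ge0.
Qed.

End Dyadic.
Arguments grid_pt {R I} m k.

Lemma measurable_norm_ge (R : realType) (d : measure_display)
    (T : measurableType d) (X : T -> R) (t : R) :
  measurable_fun setT X -> measurable [set o | t <= `|X o|].
Proof.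
move=> mX; have mN : measurable_fun setT (fun o => `|X o|).
  exact: measurableT_comp.
have := mN measurableT _ (measurable_itv `[t, +oo[); rewrite setTI.
congr measurable; apply/seteqP; split => o /=; by rewrite in_itv/= andbT.
Qed.

Section Modification.
Context {R : realType} {I : nat} {d : measure_display} {T : measurableType d}
  {P : probability T R}.
Context (F : 'rV[R]_I -> nat -> {RV P >-> R}) (K : R).
Hypothesis K0 : 0 <= K.
Hypothesis tail : forall (p : nat) (x y : 'rV[R]_I) (i : nat) (t : R),
  (0 < p)%N -> 0 < t ->
  (P [set o | t <= `|F x i o - F y i o|]%R <=
    (moment_bound p * (K * dotp (x - y) (x - y)) ^+ p / t ^+ p.*2)%:E)%E.

Let mincr (x y : 'rV[R]_I) (i : nat) (t : R) :
  measurable [set o | t <= `|F x i o - F y i o|].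
Proof. by apply: measurable_norm_ge; exact: measurable_funB. Qed.

Let near_tail (p m : nat) (x y : 'rV[R]_I) (i : nat) (theta : R) :
  (0 < p)%N -> 0 < theta -> grid_near m x y ->
  (P [set o | theta ^+ m <= `|F x i o - F y i o|]%R <=
    (moment_bound p * (K * (I%:R * 4)) ^+ p *
      ((4 * theta ^+ 2)^-1 ^+ p) ^+ m)%:E)%E.
Proof.
move=> p0 t0 /grid_near_dotp hxy; have tm0 := exprn_gt0 m t0.
apply: le_trans (tail x y i p0 tm0) _; rewrite lee_fin.
have -> : moment_bound p * (K * (I%:R * 4)) ^+ p *
      ((4 * theta ^+ 2)^-1 ^+ p) ^+ m =
    moment_bound p * (K * (I%:R * 4 * 4 ^- m)) ^+ p / (theta ^+ m) ^+ p.*2.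
  have E : 4 ^- m / (theta ^+ m) ^+ 2 = (4 * theta ^+ 2)^-1 ^+ m.
    by rewrite exprVn -invfM exprAC -exprMn.
  rewrite -mul2n [(theta ^+ m) ^+ _]exprM -[X in _ * X = _]exprM mulnC exprM -E.
  by rewrite [K * (_ * 4 ^- m)]mulrA !(exprMn p) !mulrA [_ ^- 2 ^+ p]exprVn (exprMn p).
apply: ler_wpM2r; first by rewrite invr_ge0 exprn_ge0 ?ltW.
apply: ler_wpM2l; first exact/ltW/moment_bound_gt0.
have hK : K * dotp (x - y) (x - y) <= K * (I%:R * 4 * 4 ^- m) by rewrite ler_wpM2l.
have K1 : 0 <= K * dotp (x - y) (x - y) by rewrite mulr_ge0 ?dotp_ge0.
by rewrite lerXn2r ?nnegrE// (le_trans K1 hK).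
Qed.

Lemma ae_dyadic_modulus (gamma : R) : 0 < gamma < 1 ->
  {ae P, forall o, exists N,
    dyadic_modulus (2 `^ (- gamma)) N (fun x i => F x i o)}.
Proof.
move=> /powR2N_itv; set theta := 2 `^ (- gamma) => /andP[th2 th1].
have th0 : 0 < theta by apply: lt_trans th2; rewrite divr_gt0.
pose rho := (4 * theta ^+ 2)^-1.
have rho0 : 0 < rho by rewrite invr_gt0 mulr_gt0// exprn_gt0.
have rho1 : rho < 1 by rewrite invf_lt1 ?mulr_gt0 ?exprn_gt0//; nra.
have [p p0 hp] : exists2 p, (0 < p)%N & 2 * 16 ^+ I * rho ^+ p < 1.
  have : \forall p \near \oo, `|rho ^+ p| < (2 * 16 ^+ I)^-1.
    apply: cvgr0_norm_lt; last by rewrite invr_gt0 mulr_gt0// exprn_gt0.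
    by apply: cvg_expr; rewrite ger0_norm// ltW.
  move=> [p1 _ hp1]; exists p1.+1 => //; have := hp1 p1.+1 (leqnSn _).
  rewrite ger0_norm ?exprn_ge0 ?(ltW rho0)// -[X in _ < X]mul1r.
  by rewrite ltr_pdivlMr ?mulr_gt0 ?exprn_gt0// mulrC.
pose G m := {ffun 'I_I -> 'I_(2 * 4 ^ m).+1}.
pose A m := \big[setU/set0]_(z : 'I_m * (G m * G m) |
    grid_near m (grid_pt m z.2.1 : 'rV[R]_I) (grid_pt m z.2.2))
  [set o | theta ^+ m <= `|F (grid_pt m z.2.1) z.1 o - F (grid_pt m z.2.2) z.1 o|].
pose e m := moment_bound p * (K * (I%:R * 4)) ^+ p * (rho ^+ p) ^+ m.
have e0 m : 0 <= e m.
  rewrite !mulr_ge0 ?(ltW (moment_bound_gt0 _ _))// exprn_ge0 ?mulr_ge0//.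
  by rewrite exprn_ge0// ltW.
have hA m : measurable (A m) /\
    (P (A m) <= (#|{: 'I_m * (G m * G m)}|%:R * e m)%:E)%E.
  apply: bigsetU_measure_le => // z Qz; split; first exact: mincr.
  exact: near_tail.
have : {ae P, forall o, exists N, forall m, (N <= m)%N -> ~ A m o}.
  apply: (@borel_cantelli_geometric _ _ _ _ _
    (16 ^+ I * (moment_bound p * (K * (I%:R * 4)) ^+ p)) (2 * 16 ^+ I * rho ^+ p)).
  - rewrite mulr_ge0 ?exprn_ge0//.
    by rewrite mulr_ge0 ?exprn_ge0 ?mulr_ge0// ltW// moment_bound_gt0.
  - by rewrite hp andbT mulr_ge0 ?mulr_ge0 ?exprn_ge0 ?(ltW rho0).
  - by move=> m; have [] := hA m.
  - move=> m; have [_ hm] := hA m; apply: le_trans hm _; rewrite lee_fin.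
    have card_le : #|{: 'I_m * (G m * G m)}|%:R <= 16 ^+ I * (2 * 16 ^+ I) ^+ m :> R.
      rewrite !card_prod !card_ffun !card_ord.
      have -> : 16 ^+ I * (2 * 16 ^+ I) ^+ m =
          (2 ^ m * ((4 ^ m.+1) ^ I * (4 ^ m.+1) ^ I))%:R :> R.
        have -> : ((4 ^ m.+1) ^ I * (4 ^ m.+1) ^ I = 16 ^ I * (16 ^ I) ^ m)%N.
          by rewrite -expnMn -expnMn -expnM mulnC expnM expnS.
        by rewrite !natrM !natrX exprMn mulrCA.
      have M4 : ((2 * 4 ^ m).+1 <= 4 ^ m.+1)%N.
        by rewrite expnS; have := expn_gt0 4 m; lia.
      have MI : ((2 * 4 ^ m).+1 ^ I <= (4 ^ m.+1) ^ I)%N.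
        by have [->//|I0] := posnP I; rewrite leq_exp2r.
      by rewrite ler_nat !leq_mul// ltnW// ltn_expl.
    apply: le_trans (ler_wpM2r (e0 m) card_le) _.
    by rewrite /e [X in _ <= _ * X]exprMn mulrACA mulrA.
apply: filterS => o [N hN]; exists N => m i k k' Nm im kk.
rewrite leNgt; apply/negP => /ltW hlt; apply: (hN m Nm).
by rewrite /A (bigD1 (Ordinal im, (k, k')))//=; left.
Qed.

Lemma ae_dyadic_cvg (x : 'rV[R]_I) :
  {ae P, forall o, forall i, (fun m => F (dyadic m x) i o) @ \oo --> F x i o}.
Proof.
apply: ae_foralln => i.
have near_x m : grid_near m (dyadic m x) x.
  apply/forallP => j; have /andP[a1 a2] := dyadic_itv m x j.
  have := expr2V_gt0 (R := R) m; rewrite ler_norml => h.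
  by apply/andP; split; lra.
have : {ae P, forall o, exists N, forall m, (N <= m)%N ->
    ~ [set o | (3 / 4) ^+ m <= `|F (dyadic m x) i o - F x i o|] o}.
  apply: (@borel_cantelli_geometric _ _ _ _ _
    (moment_bound 1 * (K * (I%:R * 4))) (4 / 9)).
  - by rewrite mulr_ge0 ?mulr_ge0// ltW// moment_bound_gt0.
  - by apply/andP; split; lra.
  - by move=> m; exact: mincr.
  - move=> m; have t0 : 0 < 3 / 4 :> R by lra.
    have := near_tail i (isT : (0 < 1)%N) t0 (near_x m); rewrite !expr1.
    by have -> : (4 * (3 / 4) ^+ 2)^-1 = 4 / 9 :> R by field.
apply: filterS => o [N hN]; apply/cvgrPdist_lt => e e0.
have : \forall m \near \oo, `|(3 / 4) ^+ m| < e.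
  apply: cvgr0_norm_lt => //; apply: cvg_expr; rewrite ger0_norm; lra.
move=> [N1 _ hN1]; exists (maxn N N1) => // m /=; rewrite geq_max => /andP[Nm N1m].
have := hN m Nm => /= /negP; rewrite -ltNge distrC => /lt_trans; apply.
by have := hN1 m N1m; rewrite ger0_norm// exprn_ge0//; lra.
Qed.

Lemma hoelder_modification : exists Ft : 'rV[R]_I -> nat -> {RV P >-> R},
  is_version Ft F /\
  {ae P, forall o, dinfty_continuous (fun x i => Ft x i o) /\
    forall gamma : R, 0 < gamma < 1 ->
      locally_hoelder gamma (fun x i => Ft x i o)}.
Proof.
(* The limsup, unlike limn, is measurable without a convergence hypothesis. *)
pose G x i o := fine (limn_esup (fun m => (F (dyadic m x) i o)%:E)).
have GE x i o (l : R) : (fun m => F (dyadic m x) i o) @ \oo --> l -> G x i o = l.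
  move=> h; have he : (fun m => (F (dyadic m x) i o)%:E) @ \oo --> l%:E.
    by apply/fine_cvgP; split; [exact: nearW|exact: h].
  by rewrite /G (cvg_limn_einf_sup he).2.
have mG x i : measurable_fun setT (G x i).
  apply: measurableT_comp => //.
  by apply: measurable_fun_limn_esup => m; exact/measurable_EFinP.
exists (fun x i => mfun_Sub (mem_set (mG x i))); split.
  move=> x; rewrite /=.
  pose E := \bigcap_i [set o | G x i o = F x i o].
  have -> : [set o | (fun i => G x i o) = (fun i => F x i o)] = E.
    apply/seteqP; split => [z /= zE i _|z zE]; first exact: (congr1 (fun h => h i) zE).
    by apply/funext => i; exact: zE.
  have mE : measurable E.
    apply: bigcap_measurable => // i _.
    have := measurable_funB (mG x i) (measurable_funP (F x i)).
    move=> /(_ measurableT _ (measurable_set1 0)); rewrite setTI.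
    congr measurable; apply/seteqP; split => o /=.
      by move/eqP; rewrite subr_eq0 => /eqP.
    by move=> ->; rewrite subrr.
  have [N [mN N0 hN]] : {ae P, forall o, E o}.
    by have := ae_dyadic_cvg x; apply: filterS => o h i _; exact: GE.
  have EC0 : P (~` E) = 0%E.
    by apply: (subset_measure0 _ mN hN N0); exact: measurableC.
  by rewrite -[E]setCK probability_setC ?EC0 ?sube0//; exact: measurableC.
(* The modulus for the exponent gam k implies the one for every smaller exponent,
   and gam k tends to 1: countably many null sets suffice. *)
pose gam k : R := 1 - (k.+2%:R)^-1.
have gam01 k : 0 < gam k < 1.
  rewrite /gam subr_gt0 invf_lt1 ?ltr0n// ltr1n/= gtrDl oppr_lt0.
  by rewrite invr_gt0 ltr0n.
have : {ae P, forall o, forall k, exists N,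
    dyadic_modulus (2 `^ (- gam k)) N (fun x i => F x i o)}.
  by apply: ae_foralln => k; exact: ae_dyadic_modulus.
apply: filterS => o ho /=.
have GoE : (fun x i => G x i o) = dyadic_lim (fun x i => F x i o).
  apply/funext => x; apply/funext => i; apply: GE.
  have [N hN] := ho 0%N; apply: dyadic_cvg hN i x.
  by rewrite powR_gt0//=; have /andP[] := powR2N_itv (gam01 0%N).
have hoel (gamma : R) : 0 < gamma < 1 -> locally_hoelder gamma (fun x i => G x i o).
  move=> /andP[g0 g1]; rewrite GoE.
  have [k gk] : exists k, gamma <= gam k.
    exists (Num.truncn (1 - gamma)^-1); rewrite /gam lerBrDl -lerBrDr.
    rewrite -[leRHS]invrK lef_pV2 ?posrE ?ltr0n ?invr_gt0 ?subr_gt0//.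
    by apply: le_trans (ltW (truncnS_gt _)) _; rewrite ler_nat.
  have [N hN] := ho k; apply: (@dyadic_lim_locally_hoelder _ _ _ N); first by rewrite g0.
  apply: dyadic_modulusW hN; rewrite powR_ge0/= ler_powR ?ler1n//.
  by rewrite lerN2.
split => //; apply: (@locally_hoelder_continuous _ _ (2^-1)); first by rewrite invr_gt0.
by apply: hoel; apply/andP; split; lra.
Qed.

End Modification.

Lemma limit_process_tail (R : realType) (I : nat) (sw sb : R) (phi : R -> R)
    (hphi : continuous phi) (hlip : lipschitz phi) (l : nat)
    (d : measure_display) (T : measurableType d) (P : probability T R)
    (F : 'rV[R]_I -> nat -> {RV P >-> R}) :
  is_limit_process sw sb phi l.+1 F ->
  exists2 K : R, 0 <= K &
    forall (p : nat) (x y : 'rV[R]_I) (i : nat) (t : R), (0 < p)%N -> 0 < t ->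
    (P [set o | t <= `|F x i o - F y i o|]%R <=
      (moment_bound p * (K * dotp (x - y) (x - y)) ^+ p / t ^+ p.*2)%:E)%E.
Proof.
move=> [gF _]; have [K K0 hK] := limit_cov_incr_le I sw sb hphi hlip l.
exists K => // p x y i t p0 t0.
pose z (r : 'I_2) := if r == ord0 then x else y.
have mD : measurable_fun setT (fun o => F x i o - F y i o).
  exact: measurable_funB.
have hv : is_normal0 (cov_incr (limit_cov sw sb phi l.+1 z) ord0 ord_max)
    (pushforward P (fun o => F x i o - F y i o)).
  have := gaussian0_incr_normal ord0 ord_max (gF i 2 z).
  congr is_normal0; apply/funext => A; rewrite /pushforward; congr (P _).
  by apply/seteqP; split => o /=; rewrite !tnth_mktuple.
apply: le_trans (normal0_tail_le mD hv p0 t0) _; rewrite lee_fin.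
have tp : 0 < t ^+ p.*2 by rewrite exprn_gt0.
apply: ler_wpM2r; first by rewrite invr_ge0 ltW.
apply: ler_wpM2l; first exact/ltW/moment_bound_gt0.
have v0 : 0 <= cov_incr (limit_cov sw sb phi l.+1 z) ord0 ord_max by case: hv.
have := hK 2 z ord0 ord_max; rewrite /z /= => h.
by rewrite lerXn2r ?nnegrE// mulr_ge0 ?dotp_ge0.
Qed.

Theorem lemma5 (R : realType) (I : nat) (sw sb : R) (hsw : 0 < sw) (hsb : 0 < sb)
    (phi : R -> R) (hphi : continuous phi) (hlip : lipschitz phi)
    (l : nat) (hl : (2 <= l)%N)
    (d : measure_display) (T : measurableType d) (P : probability T R)
    (w : weight_index I -> {RV P >-> R}) (b : nat -> nat -> {RV P >-> R})
    (hwb : network_parameters sw sb w b)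
    (d' : measure_display) (T' : measurableType d') (P' : probability T' R)
    (F : 'rV[R]_I -> nat -> {RV P' >-> R})
    (hF : is_limit_process sw sb phi l F) :
  (forall n : nat, (1 <= n)%N ->
     {ae P, forall o, dinfty_continuous (fun x i => network phi w b n l x i o)} /\
     exists H : {RV P >-> R},
       {ae P, forall o,
          lipschitz_with (H o) (fun x i => network phi w b n l x i o)}) /\
  (exists Ft : 'rV[R]_I -> nat -> {RV P' >-> R},
     is_version Ft F /\
     {ae P', forall o,
        dinfty_continuous (fun x i => Ft x i o) /\
        forall gamma : R, 0 < gamma < 1 ->
          locally_hoelder gamma (fun x i => Ft x i o)}).
Proof.
have [L L0 lipphi] := lipschitz_bound hlip.
case: l hl hF => [|[|m]]// _ hF; split.
  move=> n _;
  have [hw _ _ _ _] := hwb.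
  have [H hH] := network_ae_lipschitz L0 lipphi b hw n m.
  split; last by exists H.
  by apply: filterS hH => o; exact: lipschitz_with_continuous.
have [K K0 tailF] := limit_process_tail hphi hlip hF.
exact: hoelder_modification K0 tailF.
Qed.
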